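(* Let $\varepsilon_{\mathrm{in}}>0$ be an inner accuracy. For a given $\lambda\in\mathbb{R}^m$, let $z^*(\lambda)$ denote an optimal solution of $\min_{z\in Z}\mathcal{L}_\rho(z,\lambda)$, let $Z^*(\lambda)$ denote the set of all its optimal solutions, and consider the following criteria for a point $\bar z(\lambda)$: (a) $\bar z(\lambda)\in Z$ and $\mathcal{L}_\rho(\bar z(\lambda),\lambda)-\mathcal{L}_\rho(z^*(\lambda),\lambda)\le\varepsilon_{\mathrm{in}}^2$; (b) $\bar z(\lambda)\in Z$ and $\mathrm{dist}(\bar z(\lambda),Z^*(\lambda))\le\mathcal{O}(\varepsilon_{\mathrm{in}})$; (c) $\bar z(\lambda)\in Z$ and $\langle\nabla\mathcal{L}_\rho(\bar z(\lambda),\lambda),z-\bar z(\lambda)\rangle\ge-\mathcal{O}(\varepsilon_{\mathrm{in}})$ for all $z\in Z$; (d) $\bar z(\lambda)\in Z$ and $\mathrm{dist}\big(0,\nabla\mathcal{L}_\rho(\bar z(\lambda),\lambda)+\mathcal{N}_Z(\bar z(\lambda))\big)\le\mathcal{O}(\varepsilon_{\mathrm{in}})$. These conditions satisfy the following: (i) Let $\nabla\mathcal{L}_\rho$ be Lipschitz continuous with a Lipschitz constant $L_{\mathrm p}$. Then (a) $\Rightarrow$ (c), (b) $\Rightarrow$ (c), and (d) $\Rightarrow$ (c). (ii) If, in addition, $\mathcal{L}_\rho$ is strongly convex with a convexity parameter $\sigma_{\mathrm p}>0$, then (d) $\Rightarrow$ (a) $\Rightarrow$ (b).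
   Context: Setting: $f:\mathbb{R}^n\to\mathbb{R}$ is a convex function, $A\in\mathbb{R}^{m\times n}$ has full row rank, $b\in\mathbb{R}^m$, $Z\subset\mathbb{R}^n$ is a compact convex set that is simple (projection onto it is computationally cheap), and $\rho>0$ is a penalty parameter. Norms and inner products are Euclidean. The augmented Lagrangian is $\mathcal{L}_\rho(z,\lambda)=f(z)+\langle\lambda,Az-b\rangle+\frac{\rho}{2}\|Az-b\|^2$, and $\nabla\mathcal{L}_\rho$ is its gradient with respect to $z$ (assumed to exist); Lipschitz continuity of the gradient and strong convexity are with respect to $z$. $\mathcal{N}_Z(\tilde z)=\{s:\langle s,z-\tilde z\rangle\le 0\ \ \forall z\in Z\}$ is the normal cone of $Z$ at $\tilde z\in Z$, and $\mathrm{dist}(y,S)$ is the Euclidean distance from the point $y$ to the set $S$. $\mathcal{O}(\varepsilon_{\mathrm{in}})$ is the usual order notation: a quantity bounded by a constant, not depending on $\varepsilon_{\mathrm{in}}$, times $\varepsilon_{\mathrm{in}}$; the constants are left unspecified and may differ from one criterion to another. *)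

(* Defs.v *)
From HB Require Import structures.
From mathcomp Require Import all_boot all_order all_algebra.
From mathcomp Require Import all_classical all_reals all_analysis.

Set Implicit Arguments.
Unset Strict Implicit.
Unset Printing Implicit Defensive.

Import Order.TTheory GRing.Theory Num.Theory.
Import numFieldNormedType.Exports.

Local Open Scope classical_set_scope.
Local Open Scope ring_scope.

(* The library norm on 'cV[R]_n is the sup norm (it induces the usual topology,
   hence the usual compactness and differentiability); quantitative notions
   below use the Euclidean norm instead. *)
Definition edot (R : realType) (n : nat) (u v : 'cV[R]_n) : R :=
  \sum_(i < n) u i 0 * v i 0.

Definition enorm (R : realType) (n : nat) (u : 'cV[R]_n) : R :=
  Num.sqrt (edot u u).

(* [inf] is the real-valued infimum, so this is only meaningful for a nonempty
   S (inf set0 = 0). Both uses below are of this kind: the set of minimizers is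
   nonempty as soon as a minimizer is given, and a normal cone contains 0. *)
Definition eucl_dist (R : realType) (n : nat) (y : 'cV[R]_n) (S : set 'cV[R]_n) : R :=
  inf [set enorm (y - s) | s in S].

Definition grad (R : realType) (n : nat) (F : 'cV[R]_n -> R) (z : 'cV[R]_n) :
    'cV[R]_n :=
  \col_(i < n) 'D_(delta_mx i 0) F z.

Definition elipschitz (R : realType) (n : nat) (k : R)
    (G : 'cV[R]_n -> 'cV[R]_n) : Prop :=
  forall x y : 'cV[R]_n, enorm (G x - G y) <= k * enorm (x - y).

Definition strongly_convex (R : realType) (n : nat) (sigma : R)
    (F : 'cV[R]_n -> R) : Prop :=
  forall (x y : 'cV[R]_n) (t : R), 0 <= t <= 1 ->
    F (t *: x + (1 - t) *: y) <=
      t * F x + (1 - t) * F y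
      - sigma / 2 * (t * (1 - t)) * enorm (x - y) ^+ 2.

Definition normal_cone (R : realType) (n : nat) (Z : set 'cV[R]_n)
    (zt : 'cV[R]_n) : set 'cV[R]_n :=
  [set s | forall z, Z z -> edot s (z - zt) <= 0].

Definition argmin (R : realType) (n : nat) (F : 'cV[R]_n -> R)
    (Z : set 'cV[R]_n) : set 'cV[R]_n :=
  [set z | Z z /\ forall y, Z y -> F z <= F y].

(* lam precedes z so that [augL f A b rho lam] is the function of z whose
   gradient, Lipschitz constant and convexity parameter are considered. *)
Definition augL (R : realType) (m n : nat) (f : 'cV[R]_n -> R)
    (A : 'M[R]_(m, n)) (b : 'cV[R]_m) (rho : R) (lam : 'cV[R]_m)
    (z : 'cV[R]_n) : R :=
  f z + edot lam (A *m z - b) + rho / 2 * enorm (A *m z - b) ^+ 2.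

(* In the criteria, F stands for z |-> L_rho(z, lambda), and C is the constant
   hidden in O(eps): "<= O(eps)" reads "<= C * eps". *)
Section Criteria.
Context (R : realType) (n : nat).
Implicit Types (F : 'cV[R]_n -> R) (Z : set 'cV[R]_n) (zs zb : 'cV[R]_n).

Definition crit_a F Z zs (eps : R) zb : Prop :=
  Z zb /\ F zb - F zs <= eps ^+ 2.

Definition crit_b F Z (C eps : R) zb : Prop :=
  Z zb /\ eucl_dist zb (argmin F Z) <= C * eps.

Definition crit_c F Z (C eps : R) zb : Prop :=
  Z zb /\ forall z, Z z -> edot (grad F zb) (z - zb) >= - (C * eps).

Definition crit_d F Z (C eps : R) zb : Prop :=
  Z zb /\
  eucl_dist 0 [set grad F zb + s | s in normal_cone Z zb] <= C * eps.

End Criteria.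

(* Main.v *)
Require Import Defs.
From HB Require Import structures.
From mathcomp Require Import all_boot all_order all_algebra.
From mathcomp Require Import ring lra.
From mathcomp Require Import all_classical all_reals all_analysis.
Import Order.TTheory GRing.Theory Num.Theory.
Import numFieldNormedType.Exports.
Local Open Scope classical_set_scope.
Local Open Scope ring_scope.

(** Let [k] be a nonnegative Lipschitz constant of the gradient. [Z] has finite Euclidean diameter
    [D], so the gradient is bounded on [Z] by some [G], and along a segment [F] differs from its
    linearization by at most [k] times the squared length ([grad_lipschitz_expansion]). (a) gives
    (c): a step of relative length [eps] from [zb] towards [z] stays in [Z] and cannot lower [F] by
    more than [eps ^+ 2]; dividing by [eps] bounds the slope below. (b) gives (c): the optimality
    inequality at a nearby minimizer ([argmin_grad_ge0]) is carried over to [zb] by the Lipschitz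
    bound. (d) gives (c): adding a normal vector can only decrease the pairing with [z - zb], so
    Cauchy-Schwarz applies to the short vector [grad F zb + s] ([crit_d_normal]). Under strong
    convexity, the bound from (d) is linear in the distance to [zs] while the lower model of [F] is
    quadratic in it, and completing the square gives (a). For (b), the value of [F] at the midpoint
    of [zb] and [zs] turns a small gap into a small distance. *)

Section Euclidean.
Context {R : realType} {n : nat}.
Implicit Types (u v w : 'cV[R]_n) (Z : set 'cV[R]_n).

(** * Euclidean geometry, diameter and distance *)

Lemma edotC u v : edot u v = edot v u.
Proof. by apply: eq_bigr => i _; rewrite mulrC. Qed.

Lemma edotDl u v w : edot (u + v) w = edot u w + edot v w.
Proof. by rewrite -big_split; apply: eq_bigr => i _; rewrite mxE mulrDl. Qed.

Lemma edotZl a u v : edot (a *: u) v = a * edot u v.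
Proof. by rewrite mulr_sumr; apply: eq_bigr => i _; rewrite mxE mulrA. Qed.

Lemma edotNl u v : edot (- u) v = - edot u v.
Proof. by rewrite -scaleN1r edotZl mulN1r. Qed.

Lemma edotBl u v w : edot (u - v) w = edot u w - edot v w.
Proof. by rewrite edotDl edotNl. Qed.

Lemma edotDr u v w : edot u (v + w) = edot u v + edot u w.
Proof. by rewrite edotC edotDl !(edotC u). Qed.

Lemma edotZr a u v : edot u (a *: v) = a * edot u v.
Proof. by rewrite edotC edotZl edotC. Qed.

Lemma edotNr u v : edot u (- v) = - edot u v.
Proof. by rewrite edotC edotNl edotC. Qed.

Lemma edotBr u v w : edot u (v - w) = edot u v - edot u w.
Proof. by rewrite edotDr edotNr. Qed.

Lemma edot_ge0 u : 0 <= edot u u.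
Proof. by apply: sumr_ge0 => i _; rewrite -expr2 sqr_ge0. Qed.

Lemma enorm_ge0 u : 0 <= enorm u.
Proof. exact: sqrtr_ge0. Qed.

Lemma sqr_enorm u : enorm u ^+ 2 = edot u u.
Proof. by rewrite sqr_sqrtr// edot_ge0. Qed.

Lemma enorm0_eq0 u : enorm u = 0 -> u = 0.
Proof.
move=> u0; apply/matrixP => i j; rewrite ord1 mxE.
have /eqP : edot u u = 0 by rewrite -sqr_enorm u0 expr0n.
rewrite psumr_eq0 => [/allP /(_ i)|k _]; last by rewrite -expr2 sqr_ge0.
by rewrite mem_index_enum -expr2 sqrf_eq0 => /(_ isT) /eqP.
Qed.

Lemma enormN u : enorm (- u) = enorm u.
Proof. by rewrite /enorm edotNl edotNr opprK. Qed.

Lemma enormBC u v : enorm (u - v) = enorm (v - u).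
Proof. by rewrite -enormN opprB. Qed.

Lemma sqr_enormZ a u : enorm (a *: u) ^+ 2 = a ^+ 2 * enorm u ^+ 2.
Proof. by rewrite !sqr_enorm edotZl edotZr mulrA. Qed.

Lemma enormZ a u : enorm (a *: u) = `|a| * enorm u.
Proof.
by rewrite /enorm edotZl edotZr mulrA -expr2 sqrtrM ?sqr_ge0// sqrtr_sqr.
Qed.

(** Cauchy-Schwarz: when both norms are nonzero, expand the nonnegative square of
    [enorm u *: v - enorm v *: u] and divide by the product of the norms. *)
Lemma edot_le u v : edot u v <= enorm u * enorm v.
Proof.
have [u0|u0] := eqVneq (enorm u) 0.
  by rewrite u0 (enorm0_eq0 _ u0) -(scale0r 0) edotZl !mul0r.
have [v0|v0] := eqVneq (enorm v) 0.
  by rewrite v0 (enorm0_eq0 _ v0) -(scale0r 0) edotZr mul0r mulr0.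
have ab0 : 0 < enorm u * enorm v.
  by rewrite mulr_gt0// lt0r ?u0 ?v0 enorm_ge0.
have := edot_ge0 (enorm u *: v - enorm v *: u).
rewrite !edotBl !edotBr !edotZl !edotZr -!sqr_enorm (edotC v u) => h.
by rewrite -(ler_pM2l ab0); lra.
Qed.

Lemma edot_ge u v : - (enorm u * enorm v) <= edot u v.
Proof. by rewrite lerNl -edotNl -[enorm u]enormN edot_le. Qed.

Lemma enorm_le_sup u M : `|u| <= M -> enorm u <= Num.sqrt (n%:R * M ^+ 2).
Proof.
move=> uM; apply: ler_wsqrtr; rewrite mulr_natl -[n in leRHS]card_ord -sumr_const.
apply: ler_sum => i _; rewrite -expr2 -real_normK ?num_real//.
have uiM : `|u i 0| <= M.
  apply: le_trans uM; rewrite [leRHS]mx_normrE.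
  exact: (le_bigmax _ (fun ij => `|u ij.1 ij.2|) (i, 0)).
by rewrite lerXn2r ?nnegrE// (le_trans _ uiM).
Qed.

Lemma compact_enorm_diam Z : compact Z ->
  exists2 D, 0 < D & forall x y, Z x -> Z y -> enorm (x - y) <= D.
Proof.
move=> /compact_bounded bZ; have [M _ ZM] := ex_strict_bound_gt0 bZ.
(* The root converts the sup-norm diameter bound [M + M] to the Euclidean norm; adding 1 keeps [D]
   positive even when [n] is 0. *)
exists (Num.sqrt (n%:R * (M + M) ^+ 2) + 1).
  by rewrite ltr_wpDl// sqrtr_ge0.
move=> x y Zx Zy; rewrite ler_wpDr//; apply: enorm_le_sup.
by rewrite (le_trans (ler_normB _ _))// lerD// ltW// ZM.
Qed.

Lemma convex_set_segment Z x y (t : R) : convex_set Z -> Z x -> Z y -> 0 <= t <= 1 ->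
  Z (x + t *: (y - x)).
Proof.
move=> cZ /mem_set Zx /mem_set Zy t01.
have [t0 t1] := andP t01.
have := cZ y x (Itv01 t0 t1) Zy Zx; rewrite inE.
congr Z; apply/matrixP => i j; rewrite !mxE/=.
by rewrite /unstable.onem; ring.
Qed.

Lemma eucl_dist_ge0_lbound x (S : set 'cV[R]_n) :
  lbound [set enorm (x - s) | s in S] 0.
Proof. by move=> _ [s _ <-]; exact: enorm_ge0. Qed.

Lemma eucl_dist_le x (S : set 'cV[R]_n) s :
  S s -> eucl_dist x S <= enorm (x - s).
Proof.
move=> Ss; apply: ge_inf; last by exists s.
by exists 0; exact: eucl_dist_ge0_lbound.
Qed.

Lemma eucl_dist_lt x (S : set 'cV[R]_n) e : S !=set0 -> eucl_dist x S < e ->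
  exists2 s, S s & enorm (x - s) < e.
Proof.
move=> [s0 Ss0] /inf_lt[]; first by exists (enorm (x - s0)), s0.
by move=> _ [s Ss <-] se; exists s.
Qed.

End Euclidean.

                                                                                
(** Divide by [t] and let [t] tend to 0. Concretely, if [a] were positive, [t := a / (a + |c|)]
    would give [a = t * a + t * |c| > t * c], a contradiction. *)
Lemma le0_first_order (R : realType) (a c : R) :
  (forall t, 0 < t <= 1 -> t * a <= c * t ^+ 2) -> a <= 0.
Proof.
move=> h; rewrite leNgt; apply/negP => a0.
have c0 : 0 <= `|c| := normr_ge0 c.
have cc : c <= `|c| := ler_norm c.
have k0 : 0 < a + `|c| by lra.
have t0 : 0 < a / (a + `|c|) by rewrite divr_gt0.
have tE : a / (a + `|c|) * (a + `|c|) = a by rewrite mulfVK// gt_eqF.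
have t1 : a / (a + `|c|) <= 1 by rewrite ler_pdivrMr// mul1r lerDl.
have /h : 0 < a / (a + `|c|) <= 1 by rewrite t0.
rewrite expr2 mulrCA ler_pM2l// leNgt => /negP; apply.
set t := a / _ in t0 tE t1 *.
have : t * c <= t * `|c| by rewrite ler_pM2l.
have : 0 < t * a by rewrite mulr_gt0.
lra.
Qed.

(** * First-order estimates for a function with Lipschitz gradient *)

Section Gradient.
Context {R : realType} {n : nat} (F : 'cV[R]_n -> R).
Hypothesis dF : forall z, differentiable F z.
Implicit Types (x y z d : 'cV[R]_n) (Z : set 'cV[R]_n).

Lemma derive_grad x d : 'D_d F x = edot (grad F x) d.
Proof.
rewrite deriveE// {1}(matrix_sum_delta d) exchange_big big_ord1 linear_sum.
by apply: eq_bigr => i _; rewrite linearZ/= mxE deriveE// mulrC.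
Qed.

Lemma is_derive_line x d (t : R) :
  is_derive t 1 (fun s : R => F (x + s *: d)) (edot (grad F (x + t *: d)) d).
Proof.
have E : (fun h : R => h^-1 *: (((fun s : R => F (x + s *: d)) \o shift t) (h *: 1)
              - F (x + t *: d))) =
         (fun h : R => h^-1 *: ((F \o shift (x + t *: d)) (h *: d) - F (x + t *: d))).
  apply/funext => h /=; congr (_ *: (F _ - _)).
  by apply/matrixP => i j; rewrite !mxE /GRing.scale/=; ring.
apply: DeriveDef; first by rewrite /derivable E; exact: diff_derivable.
by rewrite -derive_grad /derive E.
Qed.

Lemma mean_value_grad x d :
  exists2 c : R, 0 <= c <= 1 & F (x + d) - F x = edot (grad F (x + c *: d)) d.
Proof.
have [|s s01] := @MVT_segment R (fun s : R => F (x + s *: d))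
  (fun s => edot (grad F (x + s *: d)) d) 0 1 ler01 (fun s _ => is_derive_line x d s).
  by apply: derivable_within_continuous => s _; apply: ex_derive; exact: is_derive_line.
rewrite scale1r scale0r addr0 subr0 mulr1 => E.
by exists s => //; move: s01; rewrite in_itv.
Qed.

(** The given constant carries no sign condition, and in dimension 0 it may be negative; its
    absolute value can be used as a factor in inequalities. *)
Lemma elipschitz_norm (k : R) (G : 'cV[R]_n -> 'cV[R]_n) :
  elipschitz k G -> elipschitz `|k| G.
Proof.
by move=> h x y; apply: le_trans (h x y) _; rewrite ler_wpM2r ?enorm_ge0 ?ler_norm.
Qed.

Variable k : R.
Hypothesis k0 : 0 <= k.
Hypothesis Fk : elipschitz k (grad F).

(** The mean value theorem replaces the increment by a gradient at an intermediate point, at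
    distance at most [enorm d] from [x]. This yields [k] where integration would yield [k / 2]; the
    loss only affects hidden constants. *)
Lemma grad_lipschitz_expansion x d :
  `|F (x + d) - F x - edot (grad F x) d| <= k * enorm d ^+ 2.
Proof.
have [c /andP[c0 c1] ->] := mean_value_grad x d.
rewrite -edotBl.
have h : enorm (grad F (x + c *: d) - grad F x) * enorm d <= k * enorm d ^+ 2.
  rewrite expr2 mulrA ler_wpM2r ?enorm_ge0//; apply: le_trans (Fk _ _) _.
  rewrite addrC addKr enormZ ger0_norm// ler_wpM2l//.
  by rewrite ler_piMl ?enorm_ge0.
by rewrite ler_norml (le_trans _ (edot_ge _ _)) ?lerN2// (le_trans (edot_le _ _)).
Qed.

Lemma grad_lipschitz_upper x d :
  F (x + d) <= F x + edot (grad F x) d + k * enorm d ^+ 2.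
Proof. by have := grad_lipschitz_expansion x d; rewrite ler_norml => /andP[]; lra. Qed.

Lemma grad_lipschitz_lower x d :
  F x + edot (grad F x) d - k * enorm d ^+ 2 <= F (x + d).
Proof. by have := grad_lipschitz_expansion x d; rewrite ler_norml => /andP[]; lra. Qed.

Lemma argmin_grad_ge0 {Z x y} : convex_set Z -> argmin F Z x -> Z y ->
  0 <= edot (grad F x) (y - x).
Proof.
move=> cZ [Zx minx] Zy; rewrite -oppr_le0.
apply: (@le0_first_order _ _ (k * enorm (y - x) ^+ 2)) => t /andP[t0 t1].
have := minx _ (convex_set_segment Z x y t cZ Zx Zy _).
rewrite t1 ltW// => /(_ isT) h.
by have := grad_lipschitz_upper x (t *: (y - x)); rewrite edotZr sqr_enormZ; lra.
Qed.

(** Compare, at [x + t *: (y - x)], the upper bound from strong convexity with the lower bound from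
    the expansion. The terms linear in [t] give the claim; those in [t ^+ 2] form the constant
    passed to [le0_first_order]. *)
Lemma strongly_convex_lower (sigma : R) x y : strongly_convex sigma F ->
  F x + edot (grad F x) (y - x) + sigma / 2 * enorm (y - x) ^+ 2 <= F y.
Proof.
move=> scF; rewrite -subr_le0.
apply: (@le0_first_order _ _ ((k + sigma / 2) * enorm (y - x) ^+ 2)) => t /andP[t0 t1].
have := scF y x t; rewrite t1 ltW// => /(_ isT).
rewrite (_ : t *: y + (1 - t) *: x = x + t *: (y - x)); last first.
  by apply/matrixP => i j; rewrite !mxE; ring.
have := grad_lipschitz_lower x (t *: (y - x)); rewrite edotZr sqr_enormZ.
set e := enorm _ ^+ 2; set g := edot _ _; set Ft := F (_ + _).
by move=> h1 h2; have := le_trans h1 h2; lra.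
Qed.

Lemma edot_grad_ge {z0 z : 'cV[R]_n} {D : R} d : enorm (z - z0) <= D ->
  - ((enorm (grad F z0) + k * D) * enorm d) <= edot (grad F z) d.
Proof.
move=> zD; rewrite -[grad F z](subrK (grad F z0)) edotDl.
have := edot_ge (grad F z0) d; have := edot_ge (grad F z - grad F z0) d.
have : enorm (grad F z - grad F z0) * enorm d <= k * D * enorm d.
  by rewrite ler_wpM2r ?enorm_ge0// (le_trans (Fk _ _))// ler_wpM2l.
lra.
Qed.

(** * Implications between the criteria *)

Section Criteria.
Variables (Z : set 'cV[R]_n) (D : R) (zs : 'cV[R]_n).
Hypothesis cZ : convex_set Z.
Hypothesis D0 : 0 < D.
Hypothesis ZD : forall x y, Z x -> Z y -> enorm (x - y) <= D.
Hypothesis zs_opt : argmin F Z zs.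

(** A bound for the gradient norm on all of [Z], whose points lie within [D] of [zs]. *)
Let G := enorm (grad F zs) + k * D.

Let G0 : 0 <= G.
Proof. by rewrite addr_ge0 ?enorm_ge0// mulr_ge0// ltW. Qed.

Lemma crit_a_c (eps : R) zb : 0 < eps -> crit_a F Z zs eps zb ->
  crit_c F Z (1 + k * D ^+ 2 + G * D) eps zb.
Proof.
move=> e0 [Zzb gap]; split => // z Zz.
have dD := ZD z zb Zz Zzb; have d0 := enorm_ge0 (z - zb).
have GD0 : 0 <= G * D by rewrite mulr_ge0// ltW.
have kD0 : 0 <= k * D ^+ 2 by rewrite mulr_ge0// sqr_ge0.
(* For [eps <= 1] the step of length [eps] stays in the segment, and the summand [1 + k * D ^+ 2]
   suffices. *)
have [e1|/ltW e1] := leP eps 1.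
  have := grad_lipschitz_upper zb (eps *: (z - zb)); rewrite edotZr sqr_enormZ.
  have := zs_opt.2 _ (convex_set_segment Z zb z eps cZ Zzb Zz _).
  rewrite e1 ltW// => /(_ isT) h1 h2.
  have h3 : k * enorm (z - zb) ^+ 2 <= k * D ^+ 2.
    by rewrite ler_wpM2l// lerXn2r// ?nnegrE// ltW.
  rewrite -(ler_pM2l e0).
  have h4 : eps ^+ 2 * (k * enorm (z - zb) ^+ 2) <= eps ^+ 2 * (k * D ^+ 2).
    by rewrite ler_wpM2l// sqr_ge0.
  have h5 : 0 <= eps ^+ 2 * (G * D) by rewrite mulr_ge0// sqr_ge0.
  set e := eps * edot _ _ in h2 *; set q := enorm _ ^+ 2 in h2 h4; lra.
(* For [eps >= 1] that step could leave [Z], but the crude bound [G * D] is already at most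
   [G * D * eps]. *)
have := edot_grad_ge (z - zb) (ZD zb zs Zzb zs_opt.1); rewrite -/G.
have h1 : G * enorm (z - zb) <= G * D by rewrite ler_wpM2l.
have h2 : 0 <= (G * D) * (eps - 1) by rewrite mulr_ge0// subr_ge0.
have h3 : 0 <= k * D ^+ 2 * eps by rewrite mulr_ge0// ltW.
lra.
Qed.

Lemma crit_b_c (Cb eps : R) zb : 0 < Cb -> 0 < eps -> crit_b F Z Cb eps zb ->
  crit_c F Z (2 * Cb * (1 + G + k * D)) eps zb.
Proof.
move=> C0 e0 [Zzb dist]; split => // z Zz.
have Ce0 : 0 < Cb * eps by rewrite mulr_gt0.
(* Doubling makes the inequality strict, so a minimizer [z1] this close exists without the infimum
   having to be attained. *)
have dist' : eucl_dist zb (argmin F Z) < 2 * (Cb * eps) by lra.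
have [z1 z1_opt /ltW z1zb] := eucl_dist_lt _ _ _ (ex_intro _ zs zs_opt) dist'.
have opt := argmin_grad_ge0 cZ z1_opt Zz.
have h1 := edot_grad_ge (z1 - zb) (ZD z1 zs z1_opt.1 zs_opt.1).
have h2 := edot_ge (grad F zb - grad F z1) (z - zb).
have h3 : enorm (grad F zb - grad F z1) * enorm (z - zb) <= k * (2 * (Cb * eps)) * D.
  rewrite ler_pM ?enorm_ge0// ?ZD// (le_trans (Fk _ _))//.
  by rewrite ler_wpM2l.
have h4 : G * enorm (z1 - zb) <= G * (2 * (Cb * eps)).
  by rewrite ler_wpM2l// enormBC.
(* The pairing splits into [grad F zb - grad F z1] against [z - zb], [grad F z1] against [z - z1]
   (nonnegative), and [grad F z1] against [z1 - zb]. The 1 in the constant only secures its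
   positivity. *)
rewrite -/G in h1; rewrite edotBl in h2.
move: opt h1 h2; rewrite !edotBr.
lra.
Qed.

(** The factor [enorm (z - zb)] is kept: bounding it by [D] gives (c), while for (a) it must be
    absorbed by the quadratic term of strong convexity. *)
Lemma crit_d_normal (Cd eps : R) zb : 0 < Cd -> 0 < eps -> crit_d F Z Cd eps zb ->
  forall z, Z z -> - (2 * Cd * eps * enorm (z - zb)) <= edot (grad F zb) (z - zb).
Proof.
move=> C0 e0 [Zzb dist] z Zz.
have Ce0 : 0 < Cd * eps by rewrite mulr_gt0.
have dist' : eucl_dist 0 [set grad F zb + s | s in normal_cone Z zb] < 2 * Cd * eps.
  by lra.
have [|_ [s Ns <-]] := eucl_dist_lt _ _ _ _ dist'.
  exists (grad F zb + 0), 0 => // y _.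
  by rewrite -(scale0r 0) edotZl mul0r.
rewrite sub0r enormN => /ltW sle.
have := edot_ge (grad F zb + s) (z - zb); rewrite edotDl.
have : enorm (grad F zb + s) * enorm (z - zb) <= 2 * Cd * eps * enorm (z - zb).
  by rewrite ler_wpM2r ?enorm_ge0.
have := Ns z Zz.
lra.
Qed.

Lemma crit_d_c (Cd eps : R) zb : 0 < Cd -> 0 < eps -> crit_d F Z Cd eps zb ->
  crit_c F Z (2 * Cd * D) eps zb.
Proof.
move=> C0 e0 dzb; have Zzb := dzb.1; split => // z Zz.
apply: le_trans _ (crit_d_normal _ _ _ C0 e0 dzb z Zz).
rewrite lerN2 [leRHS]mulrAC ler_wpM2l ?ZD//.
by rewrite !mulr_ge0// ltW.
Qed.

(** With [d] the distance from [zb] to [zs], the gap is at most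
    [2 * Cd * eps * d - sigma / 2 * d ^+ 2], whose maximum over [d] is
    [2 * Cd ^+ 2 * eps ^+ 2 / sigma]. Linking [Cd] and [K] by an inequality lets either one be fixed
    first. *)
Lemma crit_d_a (sigma Cd K eps : R) zb : 0 < sigma -> strongly_convex sigma F ->
  0 < Cd -> 2 * Cd ^+ 2 <= sigma * K ^+ 2 -> 0 < eps ->
  crit_d F Z Cd eps zb -> crit_a F Z zs (K * eps) zb.
Proof.
move=> s0 scF C0 CK e0 dzb; split; first exact: dzb.1.
have := crit_d_normal _ _ _ C0 e0 dzb zs zs_opt.1.
have := strongly_convex_lower sigma zb zs scF.
set d := enorm _; set g := edot _ _ => h1 h2.
have h3 : 0 <= (sigma * d - 2 * Cd * eps) ^+ 2 := sqr_ge0 _.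
have h4 : 0 <= (sigma * K ^+ 2 - 2 * Cd ^+ 2) * eps ^+ 2.
  by rewrite mulr_ge0 ?sqr_ge0// subr_ge0.
have h5 : sigma * (F zb - F zs) <= sigma * (2 * Cd * eps * d - sigma / 2 * d ^+ 2).
  by rewrite ler_pM2l//; lra.
by rewrite -(ler_pM2l s0); lra.
Qed.

Lemma crit_a_b (sigma eps : R) zb : 0 < sigma -> strongly_convex sigma F ->
  0 < eps -> crit_a F Z zs eps zb -> crit_b F Z (2 / Num.sqrt sigma) eps zb.
Proof.
move=> s0 scF e0 [Zzb gap]; split => //.
apply: le_trans (eucl_dist_le zb _ zs zs_opt) _.
have r0 : 0 < Num.sqrt sigma by rewrite sqrtr_gt0.
rewrite mulrAC ler_pdivlMr// -(@ler_pXn2r _ 2)//; last 2 first.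
- by rewrite nnegrE mulr_ge0 ?enorm_ge0// ltW.
- by rewrite nnegrE mulr_ge0// ltW.
rewrite exprMn [Num.sqrt sigma ^+ 2]sqr_sqrtr ?(ltW s0)//.
(* At the midpoint, minimality of [zs] and strong convexity give
   [sigma / 8 * d ^+ 2 <= (F zb - F zs) / 2], with [d] the distance from [zb] to [zs]; hence the
   constant [2 / Num.sqrt sigma]. *)
have half : 0 <= (2^-1 : R) <= 1 by lra.
have := scF zb zs 2^-1 half.
have := zs_opt.2 _ (convex_set_segment Z zs zb 2^-1 cZ zs_opt.1 Zzb half).
rewrite (_ : zs + _ = 2^-1 *: zb + (1 - 2^-1) *: zs); last first.
  by apply/matrixP => i j; rewrite !mxE; ring.
move=> h1 h2; have := le_trans h1 h2; lra.
Qed.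

End Criteria.
End Gradient.

(** * Choice of the constants, uniform in [eps] and [zb] *)

Theorem lemma2p2 (R : realType) (m n : nat) (f : 'cV[R]_n -> R)
    (A : 'M[R]_(m, n)) (b : 'cV[R]_m) (Z : set 'cV[R]_n) (rho : R)
    (f_convex : convex_function setT f)
    (A_full_row_rank : row_free A)
    (Z_compact : compact Z) (Z_convex : convex_set Z)
    (rho_gt0 : 0 < rho)
    (lam : 'cV[R]_m)
    (L_differentiable : forall z, differentiable (augL f A b rho lam) z)
    (zs : 'cV[R]_n) (zs_opt : argmin (augL f A b rho lam) Z zs) :
  let L := augL f A b rho lam in
           
  (forall Lp : R, elipschitz Lp (grad L) ->
    [/\                 
        exists2 Cc : R, 0 < Cc & forall eps : R, 0 < eps ->
          forall zb, crit_a L Z zs eps zb -> crit_c L Z Cc eps zb,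
                        
        forall Cb : R, 0 < Cb ->
          exists2 Cc : R, 0 < Cc & forall eps : R, 0 < eps ->
            forall zb, crit_b L Z Cb eps zb -> crit_c L Z Cc eps zb
      &                 
        forall Cd : R, 0 < Cd ->
          exists2 Cc : R, 0 < Cc & forall eps : R, 0 < eps ->
            forall zb, crit_d L Z Cd eps zb -> crit_c L Z Cc eps zb]) /\
            
  (forall Lp sigma : R, elipschitz Lp (grad L) ->
    0 < sigma -> strongly_convex sigma L ->
    [/\                                                                       
                                                                         
        exists2 Cd : R, 0 < Cd & forall eps : R, 0 < eps ->
          forall zb, crit_d L Z Cd eps zb -> crit_a L Z zs eps zb,
        forall Cd : R, 0 < Cd ->
          exists2 K : R, 0 < K & forall eps : R, 0 < eps ->
            forall zb, crit_d L Z Cd eps zb -> crit_a L Z zs (K * eps) zb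
      &                 
        exists2 Cb : R, 0 < Cb & forall eps : R, 0 < eps ->
          forall zb, crit_a L Z zs eps zb -> crit_b L Z Cb eps zb]).
Proof.
move=> L.
have [D D0 ZD] := compact_enorm_diam _ Z_compact.
split=> [Lp /elipschitz_norm LLp|Lp sigma /elipschitz_norm LLp s0 scL].
  have k0 : 0 <= `|Lp| := normr_ge0 Lp.
  have G0 : 0 <= enorm (grad L zs) + `|Lp| * D.
    by rewrite addr_ge0 ?enorm_ge0// mulr_ge0// ltW.
  have kD0 : 0 <= `|Lp| * D by rewrite mulr_ge0// ltW.
  split.
  - exists (1 + `|Lp| * D ^+ 2 + (enorm (grad L zs) + `|Lp| * D) * D).
      by rewrite -addrA ltr_wpDr// addr_ge0// mulr_ge0 ?sqr_ge0// ltW.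
    by move=> eps e0 zb; apply: crit_a_c.
  - move=> Cb C0.
    exists (2 * Cb * (1 + (enorm (grad L zs) + `|Lp| * D) + `|Lp| * D)).
      by rewrite !mulr_gt0// -addrA ltr_wpDr// addr_ge0.
    by move=> eps e0 zb; apply: crit_b_c.
  - move=> Cd C0; exists (2 * Cd * D); first by rewrite !mulr_gt0.
    by move=> eps e0 zb; apply: crit_d_c.
have k0 : 0 <= `|Lp| := normr_ge0 Lp.
split.
(* This [Cd] gives equality in [2 * Cd ^+ 2 <= sigma * K ^+ 2] for [K = 1], so (a) holds with [eps]
   itself. *)
- exists (Num.sqrt (sigma / 2)); first by rewrite sqrtr_gt0 divr_gt0.
  move=> eps e0 zb; rewrite -[eps in crit_a _ _ _ eps]mul1r.
  apply: (crit_d_a L L_differentiable _ k0 LLp _ _ zs_opt _ _ _ _ _ s0 scL) => //.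
    by rewrite sqrtr_gt0 divr_gt0.
  by rewrite sqr_sqrtr ?divr_ge0 ?(ltW s0)//; lra.
(* Now [Cd] is prescribed, and the same equality is solved for [K]. *)
- move=> Cd C0; exists (Num.sqrt (2 * Cd ^+ 2 / sigma)).
    by rewrite sqrtr_gt0 divr_gt0// mulr_gt0// exprn_gt0.
  move=> eps e0 zb.
  apply: (crit_d_a L L_differentiable _ k0 LLp _ _ zs_opt _ _ _ _ _ s0 scL) => //.
  rewrite sqr_sqrtr; first by rewrite [leRHS]mulrC mulfVK// gt_eqF.
  by rewrite divr_ge0 ?(ltW s0)// mulr_ge0// sqr_ge0.
- exists (2 / Num.sqrt sigma); first by rewrite divr_gt0// sqrtr_gt0.
  by move=> eps e0 zb; apply: crit_a_b.
Qed.
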